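(* Let $\mathbf{k}$ be a commutative ring with identity, let $X$ be a Hoffman set, and let $A$ and $\tilde A$ be the algebra and the unitary algebra generated by $X$. Take the weight $\lambda=1$. Then the quasi-shuffle algebra $(\mathfrak{A},* )$, where $\mathfrak{A}=\mathbf{k}\langle X\rangle$, is isomorphic as a $\mathbf{k}$-algebra to the algebra $(\mathrm{Sh}^+(A),\diamond^+)$, and thus to the subalgebra $\mathbf{1}_A\otimes \mathrm{Sh}^+(A)$ of $(\mathrm{Sh}(\tilde A),\diamond)$.
   Context: Hoffman set: a locally finite set $X=\bigsqcup_{n\ge1}X_n$ (each $X_n$ finite; elements of $X_n$ have degree $n$) together with a pairing $[\cdot,\cdot]:\bar X\times\bar X\to\bar X$, $\bar X=X\cup\{0\}$, such that: (S0) $[a,0]=0$ for all $a\in\bar X$; (S1) $[a,b]=[b,a]$; (S2) $[[a,b],c]=[a,[b,c]]$ for all $a,b,c\in\bar X$; (S3) either $[a,b]=0$ for all $a,b$, or $\deg([a,b])=\deg(a)+\deg(b)$ for all $a,b\in X$ (in particular $[a,b]\in X$). Quasi-shuffle algebra: $\mathfrak{A}=\mathbf{k}\langle X\rangle$ is the free $\mathbf{k}$-module on words in $X$ (empty word $1$); the quasi-shuffle product $*$ is the $\mathbf{k}$-bilinear product with $1*w=w*1=w$ for any word $w$, and $(aw_1)*(bw_2)=a(w_1*(bw_2))+b((aw_1)*w_2)+[a,b](w_1*w_2)$ for words $w_1,w_2$ and letters $a,b\in X$ (the last term being $0$ if $[a,b]=0$). Algebras generated by $X$: $A=\mathbf{k}\{X\}$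 is the free $\mathbf{k}$-module on $X$ with multiplication the $\mathbf{k}$-bilinear extension of $[\cdot,\cdot]$ (with $0\in\bar X$ read as $0\in A$); it is a commutative, not necessarily unital, $\mathbf{k}$-algebra. $\tilde A=\mathbf{k}\oplus A$ is its unitarization, with identity denoted $\mathbf{1}_A=(1_{\mathbf{k}},0)$. Mixable shuffle product of weight $\lambda\in\mathbf{k}$ on a commutative (not necessarily unital) $\mathbf{k}$-algebra $B$: for $m,n\ge1$ let $S(m,n)$ be the set of $\sigma\in S_{m+n}$ with $\sigma^{-1}(1)<\cdots<\sigma^{-1}(m)$ and $\sigma^{-1}(m+1)<\cdots<\sigma^{-1}(m+n)$. For $\sigma\in S(m,n)$ a pair $(k,k+1)$, $1\le k<m+n$, is admissible if $\sigma(k)\le m<\sigma(k+1)$; $\mathcal{T}^\sigma$ is the set of admissible pairs. For $a=a_1\otimes\cdots\otimes a_m$, $b=b_1\otimes\cdots\otimes b_n$ and $T\subseteq\mathcal{T}^\sigma$, put $u_k=a_k$ for $k\le m$, $u_k=b_{k-m}$ for $k>m$, and let $\sigma(a\otimes b;T)\in B^{\otimes(m+n-|T|)}$ be obtained from $u_{\sigma(1)}\otimes\cdots\otimes u_{\sigma(m+n)}$ by replacing, for each $(k,k+1)\in T$, $u_{\sigma(k)}\otimes u_{\sigma(k+1)}$ by the product $u_{\sigma(k)}u_{\sigma(k+1)}$ in $B$. Then $a\diamond^+ b=\sum_{\sigma\in S(m,n)}\sum_{T\subseteq\mathcal{T}^\sigma}\lambda^{|T|}\sigma(a\otimes b;T)$.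 With scalars acting by scalar multiplication, this makes $\mathrm{Sh}^+(B):=\bigoplus_{k\ge0}B^{\otimes k}$ ($B^{\otimes0}=\mathbf{k}$) a commutative associative $\mathbf{k}$-algebra with identity $\mathbf{1}\in\mathbf{k}=B^{\otimes 0}$. If $B$ is unital, $\mathrm{Sh}(B):=B\otimes\mathrm{Sh}^+(B)$ is the tensor product algebra, with product $(a_0\otimes a)\diamond(b_0\otimes b)=(a_0b_0)\otimes(a\diamond^+b)$. $\mathrm{Sh}^+(A)$ is a subalgebra of $\mathrm{Sh}^+(\tilde A)$ via $A\hookrightarrow\tilde A$, and $\mathbf{1}_A\otimes\mathrm{Sh}^+(A)=\{\mathbf{1}_A\otimes a: a\in \mathrm{Sh}^+(A)\}\subseteq\mathrm{Sh}(\tilde A)$. *)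

(* Defs.v *)
From HB Require Import structures.
From mathcomp Require Import all_boot all_algebra all_fingroup.
From mathcomp Require Import ring_quotient finmap.
From mathcomp.classical Require Import boolp.
From mathcomp.multinomials Require Import monalg.

Set Implicit Arguments.
Unset Strict Implicit.
Unset Printing Implicit Defensive.

Import GRing.Theory.
Local Open Scope fset_scope.
Local Open Scope ring_scope.

(* The library makes {malg k[S]} a module only over a nontrivial ring; freemod
   is the same type, as a module over a possibly trivial ring. *)
Definition freemod (k : pzRingType) (S : choiceType) : Type := {malg k[S]}.

Section FreeModule.
Variables (k : pzRingType) (S : choiceType).

HB.instance Definition _ := GRing.Zmodule.on (freemod k S).

Definition freemod_scale (c : k) (f : freemod k S) : freemod k S :=
  [malg s in msupp f => c * f@_s].

Lemma freemod_scaleE c f s : (freemod_scale c f)@_s = c * f@_s.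
Proof. by rewrite mcoeffE; case: msuppP; rewrite ?mulr0. Qed.

Fact freemod_scalerA a b f :
  freemod_scale a (freemod_scale b f) = freemod_scale (a * b) f.
Proof. by apply/malgP=> s; rewrite !freemod_scaleE mulrA. Qed.

Fact freemod_scale1r : left_id 1 freemod_scale.
Proof. by move=> f; apply/malgP=> s; rewrite !freemod_scaleE mul1r. Qed.

Fact freemod_scalerDr : right_distributive freemod_scale +%R.
Proof.
by move=> c f g; apply/malgP=> s; rewrite mcoeffD !freemod_scaleE mcoeffD mulrDr.
Qed.

Fact freemod_scalerDl f : {morph freemod_scale^~ f : a b / a + b}.
Proof.
by move=> a b; apply/malgP=> s; rewrite mcoeffD !freemod_scaleE mulrDl.
Qed.

HB.instance Definition _ := GRing.Zmodule_isLmodule.Build k (freemod k S)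
  freemod_scalerA freemod_scale1r freemod_scalerDr freemod_scalerDl.

Definition basis (s : S) : freemod k S := << 1 *g s >>.

Lemma freemodE (f : freemod k S) : f = \sum_(s <- msupp f) f@_s *: basis s.
Proof.
rewrite [LHS]monalgE; apply: eq_bigr => s _; apply/malgP=> t.
by rewrite freemod_scaleE !mcoeffU mulrnAr mulr1.
Qed.

Variable W : lmodType k.

Definition linext (g : S -> W) (f : freemod k S) : W :=
  \sum_(s <- msupp f) f@_s *: g s.

Lemma linextEw g (d : {fset S}) f : msupp f `<=` d ->
  linext g f = \sum_(s <- d) f@_s *: g s.
Proof.
move=> le; rewrite [LHS](big_fset_incl _ le) => //= x xd /mcoeff_outdom ->.
by rewrite scale0r.
Qed.

Lemma linext_linear g : linear (linext g).
Proof.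
move=> c f1 f2; set f := c *: f1 + f2.
pose d := msupp f1 `|` msupp f2 `|` msupp f.
rewrite !(@linextEw _ d) ?fsubsetUr //; last first.
- by rewrite /d -fsetUA fsubsetUl.
- by rewrite /d (fsetUC (msupp f1)) -fsetUA fsubsetUl.
rewrite scaler_sumr -big_split /=; apply: eq_bigr => s _.
by rewrite mcoeffD freemod_scaleE scalerDl scalerA.
Qed.

HB.instance Definition _ g :=
  GRing.isLinear.Build k (freemod k S) W _ (linext g) (linext_linear g).

Lemma linext_basis g s : linext g (basis s) = g s.
Proof.
by rewrite (linextEw _ msuppU_le) big_seq_fset1 mcoeffUU scale1r.
Qed.

Lemma linextP (h : {linear freemod k S -> W}) f :
  h f = linext (h \o basis) f.
Proof.
by rewrite [f in LHS]freemodE linear_sum; apply: eq_bigr => s _; rewrite linearZ.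
Qed.

End FreeModule.

Lemma eq_linext (k : pzRingType) (S : choiceType) (W : lmodType k) (g1 g2 : S -> W) (f : freemod k S) :
  g1 =1 g2 -> linext g1 f = linext g2 f.
Proof. by move=> e; apply: eq_bigr => s _; rewrite e. Qed.

Section LinextFun.
Variables (k : comPzRingType) (S : choiceType) (W : lmodType k).

Lemma linext_lincomb (c : k) (g1 g2 : S -> W) (f : freemod k S) :
  linext (fun s => c *: g1 s + g2 s) f = c *: linext g1 f + linext g2 f.
Proof.
rewrite /linext scaler_sumr -big_split /=; apply: eq_bigr => s _.
by rewrite scalerDr !scalerA mulrC.
Qed.

End LinextFun.

Section Submodules.
Variables (k : pzRingType) (V : lmodType k).

Definition submodule (S : V -> Prop) : Prop :=
  S 0 /\ forall (c : k) x y, S x -> S y -> S (c *: x + y).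

Definition span (Rel : V -> Prop) (x : V) : Prop :=
  forall S, submodule S -> (forall r, Rel r -> S r) -> S x.

Definition spanb (Rel : V -> Prop) : pred V := fun x => `[< span Rel x >].

Lemma spanbP Rel x : reflect (span Rel x) (x \in spanb Rel).
Proof. exact: asboolP. Qed.

Lemma span_submodule Rel : submodule (span Rel).
Proof.
split=> [S [S0 _] _ //|c x y sx sy S smS sRS].
by case: (smS) => _; apply; [apply: sx|apply: sy].
Qed.

Lemma span_rel Rel r : Rel r -> span Rel r.
Proof. by move=> h S _; apply. Qed.

Fact spanb_zmod Rel : zmod_closed (spanb Rel).
Proof.
have [s0 sL] := span_submodule Rel.
split=> [|x y /spanbP sx /spanbP sy]; apply/spanbP => //.
by rewrite addrC -scaleN1r; apply: sL.
Qed.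

Definition span_closed Rel : zmodClosed V :=
  HB.pack (spanb Rel) (GRing.isZmodClosed.Build V (spanb Rel) (spanb_zmod Rel)).

Definition quomod (Rel : V -> Prop) : Type := Quotient.quot (span_closed Rel).

Section Quotient.
Variable Rel : V -> Prop.
Local Open Scope quotient_scope.

HB.instance Definition _ := GRing.Zmodule.on (quomod Rel).

Definition quo (x : V) : quomod Rel := \pi_(Quotient.quot (span_closed Rel)) x.
Definition quorepr (q : quomod Rel) : V := generic_quotient.repr (q : (Quotient.quot (span_closed Rel))).

Lemma quoreprK q : quo (quorepr q) = q.
Proof. exact: reprK. Qed.

Lemma quoP x y : quo x = quo y <-> span Rel (x - y).
Proof.
have E := Quotient.idealrBE (span_closed Rel) x y.
by split=> [/eqP|/spanbP sxy]; [rewrite -E => /spanbP|apply/eqP; rewrite -E].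
Qed.

Lemma quorepr_span x : span Rel (quorepr (quo x) - x).
Proof. by apply/quoP; rewrite quoreprK. Qed.

Lemma quoD x y : quo (x + y) = quo x + quo y.
Proof. exact: raddfD. Qed.

Definition quomod_scale (c : k) (q : quomod Rel) : quomod Rel :=
  quo (c *: quorepr q).

Lemma quomod_scaleE c x : quomod_scale c (quo x) = quo (c *: x).
Proof.
apply/quoP; rewrite -scalerBr -[_ *: _]addr0.
by have [s0 sL] := span_submodule Rel; apply: sL => //; apply: quorepr_span.
Qed.

Fact quomod_scalerA a b q :
  quomod_scale a (quomod_scale b q) = quomod_scale (a * b) q.
Proof. by rewrite -[q]quoreprK !quomod_scaleE scalerA. Qed.

Fact quomod_scale1r : left_id 1 quomod_scale.
Proof. by move=> q; rewrite -[q]quoreprK !quomod_scaleE scale1r. Qed.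

Fact quomod_scalerDr : right_distributive quomod_scale +%R.
Proof.
move=> c q r; rewrite -[q]quoreprK -[r]quoreprK -quoD !quomod_scaleE -quoD.
by rewrite scalerDr.
Qed.

Fact quomod_scalerDl q : {morph quomod_scale^~ q : a b / a + b}.
Proof.
by move=> a b; rewrite -[q]quoreprK !quomod_scaleE -quoD scalerDl.
Qed.

HB.instance Definition _ := GRing.Zmodule_isLmodule.Build k (quomod Rel)
  quomod_scalerA quomod_scale1r quomod_scalerDr quomod_scalerDl.

Fact quo_linear : linear quo.
Proof.
move=> c x y; rewrite quoD; congr (_ + _); exact/esym/quomod_scaleE.
Qed.

HB.instance Definition _ :=
  GRing.isLinear.Build k V (quomod Rel) _ quo quo_linear.

Lemma quorepr_ker (W : lmodType k) (h : {linear V -> W}) x :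
  (forall r, Rel r -> h r = 0) -> h (quorepr (quo x)) = h x.
Proof.
move=> h0; apply/eqP; rewrite -subr_eq0 -linearB; apply/eqP.
apply: (quorepr_span x (S := fun v => h v = 0)) => //; split=> [|c u v hu hv].
  by rewrite linear0.
by rewrite linearP hu hv scaler0 addr0.
Qed.

End Quotient.
End Submodules.

(* The map on quotients of free modules induced by a map g on the bases; it is
   meaningful when g is compatible with the relations, see quolift_quo and
   quolift2_quo. *)
Section Lift.
Variables (k : comPzRingType) (S T : choiceType) (W : lmodType k).
Variables (RS : freemod k S -> Prop) (RT : freemod k T -> Prop).

Definition quolift (g : S -> W) (x : quomod RS) : W := linext g (quorepr x).

Definition quolift2 (g : S -> T -> W) (x : quomod RS) (y : quomod RT) : W :=
  linext (fun s => linext (g s) (quorepr y)) (quorepr x).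

Lemma quolift_quo g f : (forall r, RS r -> linext g r = 0) ->
  quolift g (quo RS f) = linext g f.
Proof. exact: quorepr_ker. Qed.

Lemma quolift_linear g : (forall r, RS r -> linext g r = 0) ->
  linear (quolift g).
Proof.
move=> g0 c x y; rewrite -[x]quoreprK -[y]quoreprK -linearP !quolift_quo //.
exact: linearP.
Qed.

Lemma linextC (g : S -> T -> W) f h :
  linext (fun s => linext (g s) h) f = linext (fun t => linext (g^~ t) f) h.
Proof.
rewrite /linext; under eq_bigr do rewrite scaler_sumr.
rewrite exchange_big /=; apply: eq_bigr => t _; rewrite scaler_sumr.
by apply: eq_bigr => s _; rewrite !scalerA mulrC.
Qed.

Variable g : S -> T -> W.
Hypothesis g0l : forall r t, RS r -> linext (g^~ t) r = 0.
Hypothesis g0r : forall s r, RT r -> linext (g s) r = 0.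

Lemma quolift2_quo f h :
  quolift2 g (quo RS f) (quo RT h) = linext (fun s => linext (g s) h) f.
Proof.
rewrite /quolift2 (eq_linext _ (g2 := fun s => linext (g s) h)); last first.
  by move=> s; apply: quorepr_ker => r /g0r; apply.
apply: quorepr_ker => r rr; rewrite [LHS](linextC g r h) [LHS]big1 // => t _.
by rewrite g0l ?scaler0.
Qed.

Lemma quolift2_linearl y : linear (quolift2 g ^~ y).
Proof.
move=> c x x'; rewrite -[x]quoreprK -[x']quoreprK -[y]quoreprK -linearP.
by rewrite !quolift2_quo linearP.
Qed.

Lemma quolift2_linearr x : linear (quolift2 g x).
Proof.
move=> c y y'; rewrite -[x]quoreprK -[y]quoreprK -[y']quoreprK -linearP.
by rewrite !quolift2_quo -linext_lincomb; apply: eq_linext => s; rewrite linearP.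
Qed.

End Lift.

Record comAlgebra (k : comPzRingType) := ComAlgebra {
  ca_mod :> lmodType k;
  ca_mul : ca_mod -> ca_mod -> ca_mod;
  ca_mulA : associative ca_mul;
  ca_mulC : commutative ca_mul;
  ca_mul_linear : forall y, linear (ca_mul^~ y) }.

Record comUnitalAlgebra (k : comPzRingType) := ComUnitalAlgebra {
  cua_alg :> comAlgebra k;
  cua_one : cua_alg;
  cua_mul1 : left_id cua_one (@ca_mul _ cua_alg) }.

(* Associativity is not part of this structure: it plays no role in the notions
   of isomorphism and of subalgebra. *)
Record unitalAlgebra (k : comPzRingType) := UnitalAlgebra {
  ua_mod :> lmodType k;
  ua_one : ua_mod;
  ua_mul : ua_mod -> ua_mod -> ua_mod;
  ua_mul_linearl : forall y, linear (ua_mul^~ y);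
  ua_mul_linearr : forall x, linear (ua_mul x);
  ua_mul1l : left_id ua_one ua_mul;
  ua_mul1r : right_id ua_one ua_mul }.

Arguments ca_mul {k B} : rename.
Arguments cua_one {k B} : rename.
Arguments ua_one {k A} : rename.
Arguments ua_mul {k A} : rename.

Section Isomorphisms.
Variables (k : comPzRingType) (A B : unitalAlgebra k).

Definition algebra_morphism (f : A -> B) : Prop :=
  [/\ linear f, f ua_one = ua_one & {morph f : x y / ua_mul x y}].

Definition algebra_isomorphic : Prop :=
  exists f : A -> B, algebra_morphism f /\ bijective f.

Definition subalgebra (S : B -> Prop) : Prop :=
  [/\ submodule S, S ua_one & forall x y, S x -> S y -> S (ua_mul x y)].

Definition isomorphic_to_subalgebra (S : B -> Prop) : Prop :=
  subalgebra S /\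
  exists f : A -> B,
    [/\ algebra_morphism f, injective f & forall y, S y <-> exists x, f x = y].

End Isomorphisms.

(* Direct sum of the tensor powers of V: the free module on the finite sequences
   of elements of V modulo linearity in each entry. The relations only involve
   sequences of one length, so the quotient is graded by the length n, with
   component the n-th tensor power; in length 0 there is no relation. *)
Section TensorPowers.
Variables (k : comPzRingType) (V : lmodType k).

Variant tens_rel : freemod k (seq V) -> Prop :=
  TensRel s1 s2 c x y : tens_rel
    (basis k (s1 ++ (c *: x + y) :: s2)
     - (c *: basis k (s1 ++ x :: s2) + basis k (s1 ++ y :: s2))).

Definition tens : lmodType k := quomod tens_rel.

Definition pure (s : seq V) : tens := quo tens_rel (basis k s).

Lemma pure_multilinear s1 s2 c x y :
  pure (s1 ++ (c *: x + y) :: s2) =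
  c *: pure (s1 ++ x :: s2) + pure (s1 ++ y :: s2).
Proof. by rewrite -linearP; apply/quoP; apply: span_rel; exact: TensRel. Qed.

Definition multilinear (W : lmodType k) (g : seq V -> W) : Prop :=
  forall s1 s2 c x y,
    g (s1 ++ (c *: x + y) :: s2) = c *: g (s1 ++ x :: s2) + g (s1 ++ y :: s2).

Lemma multilinear_rel (W : lmodType k) (g : seq V -> W) : multilinear g ->
  forall r, tens_rel r -> linext g r = 0.
Proof. by move=> gL r [s1 s2 c x y]; rewrite linearB linearP /= !linext_basis gL subrr. Qed.

End TensorPowers.

Definition tens_map (k : comPzRingType) (V W : lmodType k) (h : V -> W) :
  tens V -> tens W := quolift (fun s => pure (map h s)).

Lemma tens_map_pure (k : comPzRingType) (V W : lmodType k) (h : V -> W) s :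
  linear h -> tens_map h (pure s) = pure (map h s).
Proof.
move=> hL; rewrite /tens_map quolift_quo ?linext_basis //.
apply: multilinear_rel => s1 s2 c x y.
by rewrite !map_cat /= hL pure_multilinear.
Qed.

(* Permutations of {1,...,m+n} are permutations of 'I_(m + n), whose elements
   lshift n i and rshift m j stand for 1,...,m and m+1,...,m+n. *)
Definition shuffles (m n : nat) : {set 'S_(m + n)} :=
  [set s : 'S_(m + n) |
    [forall i : 'I_m, forall j : 'I_m,
       (i < j)%N ==> (s^-1%g (lshift n i) < s^-1%g (lshift n j))%N] &&
    [forall i : 'I_n, forall j : 'I_n,
       (i < j)%N ==> (s^-1%g (rshift m i) < s^-1%g (rshift m j))%N]].

Definition admissible (m n : nat) (s : 'S_(m + n)) :
    {set 'I_(m + n) * 'I_(m + n)} :=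
  [set p : 'I_(m + n) * 'I_(m + n) |
    [&& p.2 == p.1.+1 :> nat, s p.1 < m & m <= s p.2]%N].

Section MixableShuffle.
Variables (k : comPzRingType) (lambda : k) (B : comAlgebra k).

(* A flagged entry is multiplied with the next one. Two consecutive entries are
   never both flagged below, since admissible pairs are disjoint. *)
Fixpoint contract (s : seq (B * bool)) : seq B :=
  match s with
  | (x, true) :: (y, _) :: s' => ca_mul x y :: contract s'
  | (x, _) :: s' => x :: contract s'
  | [::] => [::]
  end.

Definition mixed_word (m n : nat) (u : nat -> B) (s : 'S_(m + n))
    (T : {set 'I_(m + n) * 'I_(m + n)}) : seq B :=
  contract [seq (u (s i), [exists j, (i, j) \in T]) | i <- enum 'I_(m + n)].

Definition mixable_sum (m n : nat) (u : nat -> B) : tens B :=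
  \sum_(s in shuffles m n)
   \sum_(T : {set 'I_(m + n) * 'I_(m + n)} | T \subset admissible s)
     lambda ^+ #|T| *: pure (mixed_word u s T).

Definition mixable_pure (a b : seq B) : tens B :=
  match a, b with
  | [::], _ => pure b
  | _, [::] => pure a
  | _, _ => mixable_sum (size a) (size b) (nth 0 (a ++ b))
  end.

Definition mixable : tens B -> tens B -> tens B := quolift2 mixable_pure.

Lemma ca_mul_linearr (x : B) : linear (ca_mul x).
Proof.
by move=> c y z; rewrite ca_mulC ca_mul_linear; congr (_ *: _ + _); apply: ca_mulC.
Qed.

Lemma contract_entry n s1 b s2 : (size s1 < n)%N -> exists w1 w2 (g : B -> B),
  linear g /\ forall x, contract (s1 ++ (x, b) :: s2) = w1 ++ g x :: w2.
Proof.
elim: n s1 => // n IH [|[y [|]] s1] /= lt_s1.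
- have idL : linear (@id B) by [].
  clear IH; case: b; last by exists [::], (contract s2), id.
  case: s2 => [|[y b'] s2]; first by exists [::], [::], id.
  by exists [::], (contract s2), (ca_mul^~ y); split=> //; apply: ca_mul_linear.
- case: s1 lt_s1 => [|[z b'] s1] /= lt_s1.
    by exists [::], (contract s2), (ca_mul y); split=> //; apply: ca_mul_linearr.
  have [|w1 [w2 [g [gL gE]]]] := IH s1; first by apply: ltnW; rewrite -ltnS.
  by exists (ca_mul y z :: w1), w2, g; split=> // x; rewrite gE.
- have [//|w1 [w2 [g [gL gE]]]] := IH s1.
  by exists (y :: w1), w2, g; split=> // x; rewrite gE.
Qed.

Lemma mixable_sum_linear m n (p : nat) c (u v w : nat -> B) : (p < m + n)%N ->
  u p = c *: v p + w p -> (forall i, i != p -> u i = v i /\ u i = w i) ->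
  mixable_sum m n u = c *: mixable_sum m n v + mixable_sum m n w.
Proof.
move=> lt_p up uD; rewrite /mixable_sum.
rewrite scaler_sumr -big_split /=; apply: eq_bigr => s _.
rewrite scaler_sumr -big_split /=; apply: eq_bigr => T _.
rewrite scalerA mulrC -scalerA -scalerDr; congr (_ *: _).
pose i := s^-1%g (Ordinal lt_p).
have si : s i = p :> nat by rewrite permKV.
have [e1 [e2 [eE ie1 ie2]]] : exists e1 e2,
    [/\ enum 'I_(m + n) = e1 ++ i :: e2, i \notin e1 & i \notin e2].
  have := enum_uniq 'I_(m + n); have := mem_enum 'I_(m + n) i.
  case/splitPr => e1 e2; rewrite cat_uniq /= negb_or => /and4P[_ /andP[? _] ? _].
  by exists e1, e2.
have mapE e : i \notin e ->
    [seq (u (s j), [exists l, (j, l) \in T]) | j <- e] =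
    [seq (v (s j), [exists l, (j, l) \in T]) | j <- e] /\
    [seq (u (s j), [exists l, (j, l) \in T]) | j <- e] =
    [seq (w (s j), [exists l, (j, l) \in T]) | j <- e].
  move=> ie; split; apply/eq_in_map => j je.
  - have /uD [-> _] // : s j != p :> nat.
    by apply: contraNneq ie; rewrite -si => /val_inj /perm_inj <-.
  - have /uD [_ ->] // : s j != p :> nat.
    by apply: contraNneq ie; rewrite -si => /val_inj /perm_inj <-.
rewrite /mixed_word eE !map_cat /= si.
have [<- <-] := mapE _ ie1; have [<- <-] := mapE _ ie2.
have [w1 [w2 [g [gL gE]]]] := contract_entry
  [exists l, (i, l) \in T]
  [seq (u (s j), [exists l, (j, l) \in T]) | j <- e2]
  (ltnSn (size [seq (u (s j), [exists l, (j, l) \in T]) | j <- e1])).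
by rewrite !gE up gL pure_multilinear.
Qed.

Lemma mixable_pure_linearl b : multilinear (mixable_pure^~ b).
Proof.
case: b => [|b0 b] s1 s2 c x y.
  have E a : mixable_pure a [::] = pure a by case: a.
  by rewrite !E pure_multilinear.
have E z : mixable_pure (s1 ++ z :: s2) (b0 :: b) =
    mixable_sum (size s1 + (size s2).+1) (size b).+1
      (nth 0 (s1 ++ z :: s2 ++ b0 :: b)).
  rewrite -[(size s2).+1]/(size (z :: s2)) -size_cat -[z :: s2 ++ _]cat_cons.
  by rewrite catA; case: s1.
rewrite !E; apply: (@mixable_sum_linear _ _ (size s1)).
- by rewrite -!addnA addnC addSn ltnS leq_addl.
- by rewrite !nth_cat ltnn subnn.
move=> i ne; rewrite !nth_cat; case: ltngtP ne => // lt _.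
by rewrite -(subnSK lt).
Qed.

Lemma mixable_pure_linearr a : multilinear (mixable_pure a).
Proof.
case: a => [|a0 a] s1 s2 c x y; first by rewrite /= pure_multilinear.
have E z : mixable_pure (a0 :: a) (s1 ++ z :: s2) =
    mixable_sum (size a).+1 (size s1 + (size s2).+1)
      (nth 0 (((a0 :: a) ++ s1) ++ z :: s2)).
  rewrite -catA -[(size s2).+1]/(size (z :: s2)) -size_cat.
  by case: s1.
rewrite !E; apply: (@mixable_sum_linear _ _ (size (a0 :: a ++ s1))).
- by rewrite /= size_cat -addSn ltn_add2l -addn1 leq_add2l.
- by rewrite !nth_cat ltnn subnn.
move=> i; rewrite -cat_cons => ne; rewrite !nth_cat; case: ltngtP ne => // lt _.
by rewrite -(subnSK lt).
Qed.

Lemma mixable_pureE a b : mixable (pure a) (pure b) = mixable_pure a b.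
Proof.
rewrite /mixable quolift2_quo ?linext_basis //.
- by move=> r t; apply: multilinear_rel; apply: mixable_pure_linearl.
- by move=> t; apply: multilinear_rel; apply: mixable_pure_linearr.
Qed.

Lemma mixable_linearl y : linear (mixable^~ y).
Proof.
apply: quolift2_linearl.
- by move=> r t; apply: multilinear_rel; apply: mixable_pure_linearl.
- by move=> t; apply: multilinear_rel; apply: mixable_pure_linearr.
Qed.

Lemma mixable_linearr x : linear (mixable x).
Proof.
apply: quolift2_linearr.
- by move=> r t; apply: multilinear_rel; apply: mixable_pure_linearl.
- by move=> t; apply: multilinear_rel; apply: mixable_pure_linearr.
Qed.

End MixableShuffle.

Section Extensionality.
Variables (k : comPzRingType) (W : lmodType k).

Lemma freemod_ext (S : choiceType) (f g : freemod k S -> W) :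
  linear f -> linear g -> (forall s, f (basis k s) = g (basis k s)) -> f =1 g.
Proof.
move=> fL gL fg x.
pose F : {linear freemod k S -> W} := HB.pack f (GRing.isLinear.Build _ _ _ _ f fL).
pose G : {linear freemod k S -> W} := HB.pack g (GRing.isLinear.Build _ _ _ _ g gL).
rewrite (linextP F x : f x = linext (f \o @basis k S) x).
rewrite (linextP G x : g x = linext (g \o @basis k S) x).
by apply: eq_linext => s; apply: fg.
Qed.

Lemma quomod_ext (S : choiceType) (Rel : freemod k S -> Prop)
    (f g : quomod Rel -> W) : linear f -> linear g ->
  (forall s, f (quo Rel (basis k s)) = g (quo Rel (basis k s))) -> f =1 g.
Proof.
move=> fL gL fg x; rewrite -[x]quoreprK.
apply: (@freemod_ext S (f \o quo Rel) (g \o quo Rel)) => //.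
- by move=> c y z; rewrite /= linearP fL.
- by move=> c y z; rewrite /= linearP gL.
Qed.

End Extensionality.

Section ShuffleAlgebra.
Variables (k : comPzRingType) (lambda : k) (B : comAlgebra k).

Fact mixable1l : left_id (pure [::] : tens B) (@mixable k lambda B).
Proof.
apply: quomod_ext => // [|s]; first exact: mixable_linearr.
by rewrite -/(pure s) mixable_pureE.
Qed.

Fact mixable1r : right_id (pure [::] : tens B) (@mixable k lambda B).
Proof.
apply: quomod_ext => // [|s]; first exact: mixable_linearl.
by rewrite -/(pure s) mixable_pureE; case: s.
Qed.

Definition ShPlus : unitalAlgebra k :=
  UnitalAlgebra (@mixable_linearl k lambda B) (@mixable_linearr k lambda B)
    mixable1l mixable1r.

End ShuffleAlgebra.

Section TensorProduct.
Variables (k : comPzRingType) (V W : lmodType k).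

Variant tensor_rel : freemod k (V * W)%type -> Prop :=
| TensorRelL c v v' w : tensor_rel
    (basis k (c *: v + v', w) - (c *: basis k (v, w) + basis k (v', w)))
| TensorRelR c v w w' : tensor_rel
    (basis k (v, c *: w + w') - (c *: basis k (v, w) + basis k (v, w'))).

Definition tensor : lmodType k := quomod tensor_rel.

Definition tprod (v : V) (w : W) : tensor := quo tensor_rel (basis k (v, w)).

Lemma tprod_linearl w : linear (tprod^~ w).
Proof.
by move=> c v v'; rewrite -linearP; apply/quoP; apply: span_rel; exact: TensorRelL.
Qed.

Lemma tprod_linearr v : linear (tprod v).
Proof.
by move=> c w w'; rewrite -linearP; apply/quoP; apply: span_rel; exact: TensorRelR.
Qed.

Lemma bilinear_rel (U : lmodType k) (g : V * W -> U) :
  (forall w, linear (fun v => g (v, w))) -> (forall v, linear (fun w => g (v, w))) ->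
  forall r, tensor_rel r -> linext g r = 0.
Proof.
move=> gl gr r [c v v' w|c v w w'].
  by rewrite linearB linearP /= !linext_basis gl subrr.
by rewrite linearB linearP /= !linext_basis gr subrr.
Qed.

End TensorProduct.

Section TensorAlgebra.
Variables (k : comPzRingType) (A B : unitalAlgebra k).

Definition tensor_mul : tensor A B -> tensor A B -> tensor A B :=
  quolift2 (fun p q => tprod (ua_mul p.1 q.1) (ua_mul p.2 q.2)).

Let relL r t : tensor_rel r ->
  linext (fun p : A * B => tprod (ua_mul p.1 t.1) (ua_mul p.2 t.2)) r = 0.
Proof.
apply: bilinear_rel => [w|v] c x y /=.
  by rewrite ua_mul_linearl tprod_linearl.
by rewrite ua_mul_linearl tprod_linearr.
Qed.

Let relR s r : tensor_rel r ->
  linext (fun q : A * B => tprod (ua_mul s.1 q.1) (ua_mul s.2 q.2)) r = 0.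
Proof.
apply: bilinear_rel => [w|v] c x y /=.
  by rewrite ua_mul_linearr tprod_linearl.
by rewrite ua_mul_linearr tprod_linearr.
Qed.

Lemma tensor_mulE a b a' b' :
  tensor_mul (tprod a b) (tprod a' b') = tprod (ua_mul a a') (ua_mul b b').
Proof. by rewrite /tensor_mul quolift2_quo ?linext_basis. Qed.

Fact tensor_mul_linearl y : linear (tensor_mul^~ y).
Proof. exact: quolift2_linearl. Qed.

Fact tensor_mul_linearr x : linear (tensor_mul x).
Proof. exact: quolift2_linearr. Qed.

Fact tensor_mul1l : left_id (tprod ua_one ua_one) tensor_mul.
Proof.
apply: quomod_ext => // [|[a b]]; first exact: tensor_mul_linearr.
by rewrite -/(tprod a b) tensor_mulE !ua_mul1l.
Qed.

Fact tensor_mul1r : right_id (tprod ua_one ua_one) tensor_mul.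
Proof.
apply: quomod_ext => // [|[a b]]; first exact: tensor_mul_linearl.
by rewrite -/(tprod a b) tensor_mulE !ua_mul1r.
Qed.

Definition tensor_algebra : unitalAlgebra k :=
  UnitalAlgebra tensor_mul_linearl tensor_mul_linearr tensor_mul1l tensor_mul1r.

End TensorAlgebra.

Section UnitalBase.
Variables (k : comPzRingType) (lambda : k) (B : comUnitalAlgebra k).

Fact cua_mul1r : right_id cua_one (@ca_mul _ B).
Proof. by move=> x; rewrite ca_mulC cua_mul1. Qed.

Definition unital_of_com : unitalAlgebra k :=
  UnitalAlgebra (@ca_mul_linear _ B) (@ca_mul_linearr _ B) (@cua_mul1 _ B)
    cua_mul1r.

Definition Sh : unitalAlgebra k := tensor_algebra unital_of_com (ShPlus lambda B).

End UnitalBase.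

Section Unitarization.
Variables (k : comPzRingType) (A : comAlgebra k).

Let M : lmodType k := (k^o * A)%type.

Definition unit_mul (x y : M) : M :=
  ((x.1 : k) * (y.1 : k), (x.1 : k) *: y.2 + (y.1 : k) *: x.2 + ca_mul x.2 y.2).

Let one : M := (1, 0).

Let mulDl (a b c : A) : ca_mul (a + b) c = ca_mul a c + ca_mul b c.
Proof. by have := ca_mul_linear c 1 a b; rewrite !scale1r. Qed.

Let mul0 (c : A) : ca_mul 0 c = 0.
Proof. by apply: (addrI (ca_mul 0 c)); rewrite -mulDl !addr0. Qed.

Let mulZl r (a c : A) : ca_mul (r *: a) c = r *: ca_mul a c.
Proof. by have := ca_mul_linear c r a 0; rewrite mul0 !addr0. Qed.

Fact unit_mulC : commutative unit_mul.
Proof.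
move=> [r a] [s b]; rewrite /unit_mul /= mulrC ca_mulC; congr (_, _ + _).
exact: addrC.
Qed.

Fact unit_mul_linear y : linear (unit_mul^~ y).
Proof.
case: y => s b c [r a] [r' a']; apply/pair_equal_spec; split=> /=.
  by rewrite mulrDl -mulrA.
rewrite -[c *: r]/(c * r :> k) -[c *: r + r']/(c * r + r' :> k).
rewrite mulDl mulZl !scalerDl !scalerDr !scalerA [s * c]mulrC.
by rewrite [RHS]addrACA; congr (_ + _); apply: addrACA.
Qed.

Fact unit_mulA : associative unit_mul.
Proof.
have mulDr x y z : ca_mul x (y + z) = ca_mul x y + ca_mul x z :> A.
  by rewrite !(ca_mulC x) mulDl.
have mulZr r x y : ca_mul x (r *: y) = r *: ca_mul x y :> A.
  by rewrite !(ca_mulC x) mulZl.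
case=> r a [s b] [t c]; apply/pair_equal_spec; split=> /=; first exact: mulrA.
rewrite !(mulDl, mulDr, mulZl, mulZr) !scalerDr !scalerA ca_mulA.
by rewrite [t * r]mulrC [t * s]mulrC !addrA [LHS](ACl (1*2*4*6*3*5*7)).
Qed.

Fact unit_mul1 : left_id one unit_mul.
Proof.
by case=> r a; rewrite /unit_mul /= mul1r scale1r scaler0 mul0 !addr0.
Qed.

Definition unitarization : comUnitalAlgebra k :=
  @ComUnitalAlgebra k (ComAlgebra unit_mulA unit_mulC unit_mul_linear) one unit_mul1.

Definition unitarization_inj (a : A) : unitarization := (0, a).

Lemma unitarization_inj_linear : linear unitarization_inj.
Proof.
by move=> c a b; apply/pair_equal_spec; split; rewrite //= scaler0 addr0.
Qed.

End Unitarization.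

(* The carrier is X; hs_pair acts on X with an added 0, encoded by option X with
   None for 0. The set X_n consists of the elements of degree n. *)
Record HoffmanSet := {
  hs_car :> choiceType;
  hs_deg : hs_car -> nat;
  hs_deg_gt0 : forall a, (0 < hs_deg a)%N;
  hs_finite : forall n, exists s : seq hs_car,
    forall a, (a \in s) = (hs_deg a == n);
  hs_pair : option hs_car -> option hs_car -> option hs_car;
  hs_pair0 : forall a, hs_pair a None = None;
  hs_pairC : forall a b, hs_pair a b = hs_pair b a;
  hs_pairA : forall a b c, hs_pair (hs_pair a b) c = hs_pair a (hs_pair b c);
  hs_pair_deg :
    (forall a b, hs_pair a b = None) \/
    (forall a b : hs_car, exists2 c : hs_car,
       hs_pair (Some a) (Some b) = Some c & hs_deg c = (hs_deg a + hs_deg b)%N) }.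

Section QuasiShuffle.
Variables (k : comPzRingType) (X : HoffmanSet).

Definition prepend (a : X) (f : freemod k (seq X)) : freemod k (seq X) :=
  linext (fun w => basis k (a :: w)) f.

Fixpoint qshuffle_word (v : seq X) : seq X -> freemod k (seq X) :=
  match v with
  | [::] => fun w => basis k w
  | a :: v' =>
      fix qshuffle_a (w : seq X) : freemod k (seq X) :=
        match w with
        | [::] => basis k v
        | b :: w' =>
            prepend a (qshuffle_word v' w) + prepend b (qshuffle_a w')
            + (if hs_pair (Some a) (Some b) is Some c
               then prepend c (qshuffle_word v' w') else 0)
        end
  end.

Definition qshuffle (f g : freemod k (seq X)) : freemod k (seq X) :=
  linext (fun v => linext (qshuffle_word v) g) f.

Fact qshuffle_linearl g : linear (qshuffle^~ g).
Proof. exact: linext_linear. Qed.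

Fact qshuffle_linearr f : linear (qshuffle f).
Proof.
move=> c g h; rewrite /qshuffle -linext_lincomb.
by apply: eq_linext => v; apply: linext_linear.
Qed.

Fact qshuffle1l : left_id (basis k [::]) qshuffle.
Proof.
apply: freemod_ext => // [|w]; first exact: qshuffle_linearr.
by rewrite /qshuffle !linext_basis.
Qed.

Fact qshuffle1r : right_id (basis k [::]) qshuffle.
Proof.
apply: freemod_ext => // [|w]; first exact: qshuffle_linearl.
by rewrite /qshuffle !linext_basis; case: w.
Qed.

Definition QuasiShuffle : unitalAlgebra k :=
  UnitalAlgebra qshuffle_linearl qshuffle_linearr qshuffle1l qshuffle1r.

End QuasiShuffle.

Section GeneratedAlgebra.
Variables (k : comPzRingType) (X : HoffmanSet).

Definition letter (a : option X) : freemod k X :=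
  if a is Some x then basis k x else 0.

Definition gen_mul (f g : freemod k X) : freemod k X :=
  linext (fun a => linext (fun b => letter (hs_pair (Some a) (Some b))) g) f.

Fact gen_mul_linear g : linear (gen_mul^~ g).
Proof. exact: linext_linear. Qed.

Fact gen_mulC : commutative gen_mul.
Proof.
move=> f g; rewrite /gen_mul linextC.
by apply: eq_linext => a; apply: eq_linext => b; rewrite hs_pairC.
Qed.

Lemma gen_mul_letter a b : gen_mul (letter a) (letter b) = letter (hs_pair a b).
Proof.
case: a b => [a|] [b|]; rewrite ?(hs_pairC None) ?hs_pair0 /gen_mul /=.
- by rewrite !linext_basis.
- by rewrite linext_basis linear0.
- exact: linear0.
- exact: linear0.
Qed.

Fact gen_mulA : associative gen_mul.
Proof.
have mulL h : linear (gen_mul h).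
  by move=> c f g; rewrite gen_mulC gen_mul_linear !(gen_mulC _ h).
move=> f g h; move: f; apply: freemod_ext => [c x y|c x y|a].
- exact: gen_mul_linear.
- by rewrite !gen_mul_linear.
move: g; apply: freemod_ext => [c x y|c x y|b].
- by rewrite gen_mul_linear mulL.
- by rewrite mulL gen_mul_linear.
move: h; apply: freemod_ext => [c x y|c x y|d].
- by rewrite !mulL.
- by rewrite mulL.
rewrite -[basis k a]/(letter (Some a)) -[basis k b]/(letter (Some b)).
by rewrite -[basis k d]/(letter (Some d)) !gen_mul_letter hs_pairA.
Qed.

Definition generated_algebra : comAlgebra k :=
  ComAlgebra gen_mulA gen_mulC gen_mul_linear.

Definition generated_unital_algebra : comUnitalAlgebra k :=
  unitarization generated_algebra.

End GeneratedAlgebra.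

(* The subset 1_A (x) Sh^+(A) of Sh(A~), where Sh^+(A) is mapped to Sh^+(A~) by
   the map induced by the inclusion of A in A~. *)
Definition one_tensor_ShPlus (k : comPzRingType) (lambda : k) (A : comAlgebra k) :
    Sh lambda (unitarization A) -> Prop :=
  fun y => exists a : ShPlus lambda A,
    y = tprod cua_one (tens_map (@unitarization_inj k A) a).

(* Main.v *)
Require Import Defs.
From mathcomp Require Import all_boot all_algebra all_fingroup.

Set Implicit Arguments.
Unset Strict Implicit.
Unset Printing Implicit Defensive.

Import GRing.Theory.
Local Open Scope ring_scope.

(** A mixable shuffle of two tensors is determined by the sequence of choices
    that produces it from left to right: take the next entry of the first
    tensor, take the next entry of the second, or take one of each and multiply
    them. A sum over such sequences splits according to the first choice, and
    this is exactly the recursion that defines the quasi-shuffle product: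
<<
      (x a) <> (y b) = x (a <> y b) + y (x a <> b) + lambda (xy) (a <> b).
>>
    The definition of the mixable shuffle product is instead a sum over pairs
    of a permutation [s] and a set [T] of admissible positions. The bulk of the
    proof translates one into the other. A pair [(s, T)] is encoded by the word
    whose i-th letter tells whether [s i] lies in the first block and whether
    position i is merged with the next one. The shuffle condition says that
    each block occurs in increasing order, so the word of values of [s] is
    recovered by dealing the two blocks out along the code
    ([deal_choice_code]); hence the encoding is injective, and its image is
    enumerated by [choice_words] ([sum_shuffles]). The recursion is then
    [mixable_pure_cons].

    The isomorphism sends a word to the tensor of its letters. It is
    multiplicative because both products obey the same recursion, a product of
    letters in the generated algebra being their pairing (or 0). It is
    bijective because the tensor powers of a free module are free: expanding
    each entry of a tensor in the basis of letters gives the inverse.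

    For the second claim, Sh^+(A) embeds in Sh of the unitarization by
    functoriality followed by tensoring with the unit. Both steps are
    multiplicative, and both are split injections: the first by the linear
    projection of the unitarization onto A, the second by its projection onto
    the scalars. *)

(** * Words of choices *)

(** A letter [(c, f)] takes an entry from the first block when [c] holds, and
    [f] asks to merge it with the entry taken next; a merge needs an entry of
    the first block followed by one of the second. *)
Definition step_ok (x y : bool * bool) : bool := x.2 ==> (x.1 && ~~ y.1).

(** The appended letter, being of the first block, forbids a merge at the last
    position. *)
Definition choice_word (m n : nat) (e : seq (bool * bool)) : bool :=
  [&& count fst e == m, count (negb \o fst) e == n
    & sorted step_ok (rcons e (true, false))].

(** The nested fixpoint mirrors that of the quasi-shuffle product of words, so
    that sums over this list obey the same recursion. *)
Fixpoint choice_words (m : nat) : nat -> seq (seq (bool * bool)) :=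
  match m with
  | 0 => fun n => [:: nseq n (false, false)]
  | m'.+1 =>
      fix choice_words_m (n : nat) : seq (seq (bool * bool)) :=
        match n with
        | 0 => [:: nseq m (true, false)]
        | n'.+1 =>
            [seq (true, false) :: e | e <- choice_words m' n]
            ++ [seq (false, false) :: e | e <- choice_words_m n']
            ++ [seq (true, true) :: (false, false) :: e | e <- choice_words m' n']
        end
  end.

Lemma choice_words0 m : choice_words m 0 = [:: nseq m (true, false)].
Proof. by case: m. Qed.

Lemma mem_map_cons (T : eqType) (x y : T) (e : seq T) (E : seq (seq T)) :
  (x :: e \in [seq y :: f | f <- E]) = (x == y) && (e \in E).
Proof.
apply/mapP/andP => [[f fE [-> ->]]|[/eqP-> eE]]; first by rewrite eqxx.
by exists e.
Qed.

Lemma nil_map_cons (T : eqType) (y : T) (E : seq (seq T)) :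
  ([::] \in [seq y :: f | f <- E]) = false.
Proof. by apply/mapP => -[]. Qed.

Lemma map_cons2 (T : Type) (x y : T) (E : seq (seq T)) :
  [seq x :: y :: f | f <- E] = [seq x :: f | f <- [seq y :: f | f <- E]].
Proof. by rewrite -map_comp. Qed.


(** The default letter, being of the first block, makes the condition
    right also at and beyond the end of the word. *)
Lemma step_okP e : reflect
  (forall i, (nth (true, false) e i).2 ->
     (nth (true, false) e i).1 && ~~ (nth (true, false) e i.+1).1)
  (sorted step_ok (rcons e (true, false))).
Proof.
apply: (iffP (sortedP (true, false))) => eP i.
  have [lt|le] := ltnP i (size e); last by rewrite nth_default.
  have := eP i; rewrite size_rcons ltnS lt !nth_rcons_default => /(_ isT).
  by move/implyP.
by rewrite !nth_rcons_default => _; apply/implyP/eP.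
Qed.

Lemma path_step_ok x e : x.2 = false ->
  path step_ok x (rcons e (true, false)) = sorted step_ok (rcons e (true, false)).
Proof. by case: e => [|y e] /= x2; rewrite /step_ok x2. Qed.

Lemma choice_wordT m n e :
  choice_word m.+1 n ((true, false) :: e) = choice_word m n e.
Proof. by rewrite /choice_word /= path_step_ok // add1n eqSS. Qed.

Lemma choice_wordF m n e :
  choice_word m n.+1 ((false, false) :: e) = choice_word m n e.
Proof. by rewrite /choice_word /= path_step_ok // add1n eqSS. Qed.

Lemma choice_wordF0 m f e : choice_word m 0 ((false, f) :: e) = false.
Proof. exact: andbF. Qed.

Lemma choice_wordTF m n e :
  choice_word m.+1 n.+1 ((true, true) :: (false, false) :: e) = choice_word m n e.
Proof. by rewrite /choice_word /= path_step_ok // !add1n !add0n !eqSS. Qed.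

Lemma mem_choice_words m n e : (e \in choice_words m n) = choice_word m n e.
Proof.
(* A merge consumes two letters, hence the induction on a bound of the size. *)
have [N] := ubnP (size e); elim: N m n e => // N IH m n e.
have memE := (mem_cat, map_cons2, @mem_map_cons (bool * bool)%type,
  @nil_map_cons (bool * bool)%type, @mem_seq1 (seq (bool * bool)), orbF).
case: e => [_|x e]; first by case: m n => [|m] [|n]; rewrite /= ?memE.
rewrite /= ltnS => le_e; case: x => [[] []].
- case: e le_e => [|[b f] e] le_e.
    by case: m n => [|m] [|n]; rewrite /= ?memE ?eqseq_cons // /choice_word !andbF.
  have [/eqP[-> ->]|/negbTE ne] := boolP ((b, f) == (false, false)).
    case: m n => [|m] [|n]; rewrite /= ?memE ?eqseq_cons ?choice_wordTF //=.
    - by rewrite /choice_word /= andbF.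
    - by rewrite IH // ltnW.
  transitivity false.
    by case: m n => [|m] [|n]; rewrite /= ?memE ?eqseq_cons //= ne.
  rewrite /choice_word; case: b f ne {le_e} => [] [] //= _; rewrite ?andbF //.
  by case: e => [|y e] /=; rewrite ?andbF.
- by case: m n => [|m] [|n];
    rewrite /= ?memE ?eqseq_cons //= ?choice_wordT -?IH ?choice_words0 ?memE.
- transitivity false.
    by case: m n => [|m] [|n]; rewrite /= ?memE ?eqseq_cons.
  by rewrite /choice_word; case: e {le_e} => [|y e] /=; rewrite !andbF.
- by case: m n => [|m] [|n];
    rewrite /= ?memE ?eqseq_cons ?choice_wordF0 ?choice_wordF -?IH ?memE.
Qed.

Lemma cons_inj (T : Type) (x : T) : injective (cons x).
Proof. by move=> s t []. Qed.

Lemma choice_words_uniq m n : uniq (choice_words m n).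
Proof.
elim: m n => // m IHm; elim=> //= n IHn.
rewrite !cat_uniq map_cons2 !(map_inj_uniq (@cons_inj _ _)) ?IHm ?IHn //=.
rewrite !has_cat negb_or -!all_predC andbT.
rewrite -!andbA; apply/and3P.
by split; apply/allP => ? /mapP[e _ ->] /=; apply/mapP => -[].
Qed.

(** * Dealing two sequences out along a word of choices *)

(** Truncates when a sequence runs out; the counts of a choice word exclude
    that. *)
Fixpoint deal (T : Type) (e : seq (bool * bool)) (s t : seq T) : seq (T * bool) :=
  match e, s, t with
  | (true, f) :: e', x :: s', _ => (x, f) :: deal e' s' t
  | (false, f) :: e', _, y :: t' => (y, f) :: deal e' s t'
  | _, _, _ => [::]
  end.

Lemma deal_map (T U : Type) (h : T -> U) e s t :
  deal e (map h s) (map h t) = [seq (h z.1, z.2) | z <- deal e s t].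
Proof.
elim: e s t => [|[[] f] e IH] [|x s] [|y t] //=.
- by rewrite -(IH _ [::]).
- by rewrite -(IH _ (_ :: _)).
- by rewrite -(IH [::]).
- by rewrite -(IH (_ :: _)).
Qed.

(** A sequence is recovered from the block each entry belongs to and from the
    two subsequences of the entries of each block. *)
Lemma deal_partition (T : Type) (c : pred T) (z : seq (T * bool)) :
  deal [seq (c p.1, p.2) | p <- z] (filter c (unzip1 z))
    (filter (predC c) (unzip1 z)) = z.
Proof.
elim: z => //= -[x f] z IH /=; case: ifP => cx /=; rewrite cx /=; rewrite IH //.
Qed.

Lemma filter_deal (T : Type) (c : pred T) e s t :
  all c s -> all (predC c) t -> 
  size s = count fst e -> size t = count (negb \o fst) e ->
  [/\ [seq (c p.1, p.2) | p <- deal e s t] = e,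
      filter c (unzip1 (deal e s t)) = s &
      filter (predC c) (unzip1 (deal e s t)) = t].
Proof.
elim: e s t => [|[[] f] e IH] /=.
- by case=> // -[].
- case=> // x s t /andP[cx cs] ct [ss] st; have [h1 h2 h3] := IH s t cs ct ss st.
  by rewrite /= cx /= h1 h2 h3.
- move=> s [|x t] // cs /andP[/= cx ct] ss [st].
  have [h1 h2 h3] := IH s t cs ct ss st.
  by rewrite /= cx (negbTE cx) h1 h2 h3.
Qed.

(** * Encoding mixable shuffles *)

Section Shuffles.
Variables m n : nat.
Implicit Types (s : 'S_(m + n)) (T : {set 'I_(m + n) * 'I_(m + n)}).

Definition perm_word s : seq nat := [seq val (s i) | i <- enum 'I_(m + n)].

Lemma size_perm_word s : size (perm_word s) = (m + n)%N.
Proof. by rewrite size_map size_enum_ord. Qed.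

Lemma nth_perm_word s (i : 'I_(m + n)) : nth 0 (perm_word s) i = s i.
Proof.
by rewrite (nth_map i) ?size_enum_ord ?ltn_ord // nth_ord_enum.
Qed.

Lemma perm_word_inj : injective perm_word.
Proof.
move=> s t st; apply/permP => i; apply/val_inj.
by rewrite /= -!nth_perm_word st.
Qed.

Lemma perm_word_iota s : perm_eq (perm_word s) (iota 0 (m + n)).
Proof.
rewrite -val_enum_ord /perm_word map_comp; apply: perm_map.
apply: uniq_perm.
- by rewrite (map_inj_uniq perm_inj) enum_uniq.
- exact: enum_uniq.
move=> i; rewrite mem_enum; apply/mapP; exists (s^-1%g i); last by rewrite permKV.
by rewrite mem_enum.
Qed.

Lemma perm_wordP (w : seq nat) : perm_eq w (iota 0 (m + n)) ->
  exists s, perm_word s = w.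
Proof.
move=> ww; have szw : size w = (m + n)%N by rewrite (perm_size ww) size_iota.
have ltw (i : 'I_(m + n)) : (nth 0 w i < m + n)%N.
  have : nth 0 w i \in w by rewrite mem_nth ?szw.
  by rewrite (perm_mem ww) mem_iota.
have inj_w : injective (fun i => Ordinal (ltw i)).
  move=> i j [/eqP]; rewrite nth_uniq ?szw ?(perm_uniq ww) ?iota_uniq //.
  by move/eqP/val_inj.
exists (perm inj_w); apply: (@eq_from_nth _ 0%N); rewrite size_perm_word ?szw //.
move=> i lti; rewrite (nth_perm_word (perm inj_w) (Ordinal lti)).
by rewrite permE.
Qed.

(** Both clauses of the shuffle condition at once, read on the values of the
    permutation instead of on its inverse. *)
Definition same_block_lt (x y : nat) : bool :=
  ((x < m) == (y < m))%N ==> (x < y)%N.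

Lemma mem_shuffles s : (s \in shuffles m n) = pairwise same_block_lt (perm_word s).
Proof.
apply/idP/(pairwiseP 0%N).
  rewrite inE => /andP[/forallP sl /forallP sr] p q.
  rewrite !inE size_perm_word => ltp ltq pq.
  pose i := Ordinal ltp; pose j := Ordinal ltq.
  rewrite -[p]/(val i) -[q]/(val j) !nth_perm_word /same_block_lt.
  apply/implyP => /eqP sij; rewrite ltnNge; apply/negP => le_ji.
  have {le_ji}lt_ji : (s j < s i)%N.
    rewrite ltn_neqAle le_ji andbT; apply/eqP => /val_inj/perm_inj ji.
    by move: pq; rewrite -[p]/(val i) -ji ltnn.
  (* A descent of s in a block is turned by s^-1 into j < i. *)
  have absurd : (j < i)%N -> False by rewrite ltnNge (ltnW pq).
  apply: absurd; rewrite -[i](permK s) -[j](permK s).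
  case: (split_ordP (s i)) sij lt_ji => a ->; case: (split_ordP (s j)) => b -> /=.
  - by move=> _ ba; apply: (implyP (forallP (sl b) a)).
  - by [].
  - by [].
  - by rewrite ltn_add2l => _ ba; apply: (implyP (forallP (sr b) a)).
move=> sP.
have sV (x y : 'I_(m + n)) : ((x < m) = (y < m))%N -> (x < y)%N ->
    (s^-1%g x < s^-1%g y)%N.
  move=> xy ltxy; rewrite ltnNge leq_eqVlt; apply/negP => /orP[/eqP/val_inj|lt].
    by move/perm_inj => yx; move: ltxy; rewrite yx ltnn.
  have := sP (s^-1%g y) (s^-1%g x); rewrite !inE size_perm_word !ltn_ord.
  rewrite !nth_perm_word !permKV /same_block_lt xy eqxx /= => /(_ isT isT lt).
  by rewrite ltnNge (ltnW ltxy).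
rewrite inE; apply/andP; split; apply/forallP => x; apply/forallP => y;
  apply/implyP => ltxy; apply: sV => //=.
- by rewrite !ltn_ord.
- by rewrite !ltnNge !leq_addr.
- by rewrite ltn_add2l.
Qed.

Lemma pairwise_partition (c : pred nat) w :
  pairwise (fun x y => (c x == c y) ==> (x < y)%N) w =
  sorted ltn (filter c w) && sorted ltn (filter (predC c) w).
Proof.
rewrite !(sorted_pairwise ltn_trans).
elim: w => //= x w ->.
have all_block : all (fun y => (c x == c y) ==> (x < y)%N) w =
    all (ltn x) (filter (if c x then c else predC c) w).
  by elim: w => //= y w ->; case: (c x) => /=; case: (c y).
by rewrite all_block; case: (c x); rewrite /= !andbA // [X in X && _]andbC.
Qed.

(** An increasing sequence is determined by the set of its entries. *)
Lemma shuffle_blocks s : s \in shuffles m n ->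
  filter (fun x => x < m)%N (perm_word s) = iota 0 m /\
  filter (predC (fun x => x < m))%N (perm_word s) = iota m n.
Proof.
rewrite mem_shuffles [pairwise _ _](pairwise_partition (fun x => x < m)%N).
case/andP => sl sr.
have mem_word x : (x \in perm_word s) = (x < m + n)%N.
  by rewrite (perm_mem (perm_word_iota s)) mem_iota.
split; apply: (irr_sorted_eq ltn_trans ltnn) => //; rewrite ?iota_ltn_sorted //.
- move=> x; rewrite mem_filter mem_word mem_iota /=.
  by case: ltnP => // lt; rewrite ltn_addr.
- by move=> x; rewrite mem_filter mem_word mem_iota /= -leqNgt.
Qed.


Definition merged (T : {set 'I_(m + n) * 'I_(m + n)}) (i : 'I_(m + n)) : bool :=
  [exists j, (i, j) \in T].

Definition choice_code s (T : {set 'I_(m + n) * 'I_(m + n)}) : seq (bool * bool) :=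
  [seq ((s i < m)%N, merged T i) | i <- enum 'I_(m + n)].

Lemma nth_choice_code s T (i : 'I_(m + n)) :
  nth (true, false) (choice_code s T) i = ((s i < m)%N, merged T i).
Proof. by rewrite (nth_map i) ?size_enum_ord ?ltn_ord // nth_ord_enum. Qed.

Lemma size_choice_code s T : size (choice_code s T) = (m + n)%N.
Proof. by rewrite size_map size_enum_ord. Qed.

Lemma unzip1_perm_word s (f : 'I_(m + n) -> bool) :
  unzip1 [seq (val (s i), f i) | i <- enum 'I_(m + n)] = perm_word s.
Proof. by rewrite /unzip1 -map_comp. Qed.

Lemma deal_choice_code s T : s \in shuffles m n ->
  deal (choice_code s T) (iota 0 m) (iota m n) =
  [seq (val (s i), merged T i) | i <- enum 'I_(m + n)].
Proof.
case/shuffle_blocks => <- <-; set z := RHS.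
rewrite -(unzip1_perm_word s (merged T)) -/z.
rewrite -[RHS](deal_partition (fun x => x < m)%N).
by congr (deal _ _ _); rewrite -map_comp.
Qed.

(** An admissible pair is determined by its first component; this is what lets
    one flag per position stand for [T]. *)
Lemma admissibleE s (T : {set 'I_(m + n) * 'I_(m + n)}) i j :
  T \subset admissible s ->
  ((i, j) \in T) = (j == i.+1 :> nat) && merged T i.
Proof.
move=> /subsetP sT; have adm i' j' : (i', j') \in T -> j' = i'.+1 :> nat.
  by move/sT; rewrite inE /= => /andP[/eqP].
apply/idP/andP => [ijT|[/eqP ji /existsP[j' ij'T]]].
  by split; [apply/eqP/adm | apply/existsP; exists j].
by rewrite (_ : j = j') //; apply/val_inj; rewrite /= ji (adm _ _ ij'T).
Qed.

Lemma choice_code_inj s s' T T' : s \in shuffles m n -> s' \in shuffles m n ->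
  T \subset admissible s -> T' \subset admissible s' ->
  choice_code s T = choice_code s' T' -> (s, T) = (s', T').
Proof.
move=> sh sh' sT sT' eq_code.
have sE : s = s'.
  apply: perm_word_inj; have := deal_choice_code T sh.
  rewrite eq_code (deal_choice_code T' sh') => /(congr1 (@unzip1 _ _)).
  by rewrite !unzip1_perm_word.
congr (_, _); first by [].
apply/setP => -[i j]; rewrite (admissibleE _ _ sT) (admissibleE _ _ sT').
have := congr1 (fun e => nth (true, false) e i) eq_code.
by rewrite /= !nth_choice_code => -[_ ->].
Qed.

(** The exponent of the weight, read off the code. *)
Lemma count_merged s T : T \subset admissible s ->
  count snd (choice_code s T) = #|T|.
Proof.
move=> sT; rewrite count_map -sum1_count big_enum_cond /= sum1_card.
rewrite -(card_in_imset (f := fst) (D := mem T)); last first.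
  move=> [i j] [i' j'] /=; rewrite !(admissibleE _ _ sT).
  move=> /andP[/eqP ji _] /andP[/eqP ji' _] ii'; rewrite -ii' in ji' *.
  by congr (_, _); apply/val_inj; rewrite /= ji.
apply: eq_card => i; rewrite unfold_in /=; apply/idP/imsetP.
  by case/existsP => j ijT; exists (i, j).
by case=> -[i' j] ijT -> /=; apply/existsP; exists j.
Qed.

Lemma choice_code_word s T : s \in shuffles m n -> T \subset admissible s ->
  choice_word m n (choice_code s T).
Proof.
move=> sh /subsetP sT; have [bl br] := shuffle_blocks sh.
apply/and3P; split.
- by have := congr1 size bl; rewrite size_iota size_filter !count_map => /eqP.
- by have := congr1 size br; rewrite size_iota size_filter !count_map => /eqP.
apply/step_okP => p.
have [lt|le] := ltnP p (m + n); last by rewrite nth_default ?size_choice_code.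
rewrite (nth_choice_code s T (Ordinal lt)) => /existsP[j /sT].
rewrite inE /= => /and3P[/eqP jp -> le]; rewrite -jp nth_choice_code /=.
by rewrite -leqNgt.
Qed.

(** Dealing the two blocks out along [e] gives the word of values of the
    shuffle; [T] is read off the flags. *)
Lemma choice_codeP e : choice_word m n e ->
  exists s T, [/\ s \in shuffles m n, T \subset admissible s & choice_code s T = e].
Proof.
case/and3P => /eqP em /eqP en /step_okP e_ok.
have sz_e : size e = (m + n)%N by rewrite -(count_predC fst) em en.
have [||||zE zl zr] := @filter_deal nat (fun x => x < m)%N e (iota 0 m) (iota m n).
- by apply/allP => x; rewrite mem_iota.
- by apply/allP => x; rewrite mem_iota /= -leqNgt => /andP[].
- by rewrite size_iota.
- by rewrite size_iota.
set z := deal _ _ _ in zE zl zr.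
have [|s sz] := @perm_wordP (unzip1 z).
  by rewrite iotaD -(perm_filterC (fun x => x < m)%N (unzip1 z)) zl zr.
have sE (i : 'I_(m + n)) : (nth (true, false) e i).1 = (s i < m)%N.
  have lt_iz : (i < size z)%N.
    by rewrite -(size_map fst) -[map _ _]sz size_perm_word.
  by rewrite -nth_perm_word sz -zE /unzip1 !(nth_map (0%N, false)).
pose T := [set p : 'I_(m + n) * 'I_(m + n) |
  (p.2 == p.1.+1 :> nat) && (nth (true, false) e p.1).2].
have sh : s \in shuffles m n.
  rewrite mem_shuffles [pairwise _ _](pairwise_partition (fun x => x < m)%N).
  by rewrite sz zl zr !iota_ltn_sorted.
exists s, T; split=> //.
  apply/subsetP => -[i j]; rewrite !inE /= => /andP[/eqP ji /e_ok].
  by rewrite -ji !sE -leqNgt => /andP[-> ->]; rewrite ji eqxx.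
apply: (@eq_from_nth _ (true, false)); rewrite size_choice_code // => p lt.
rewrite (nth_choice_code s T (Ordinal lt)) -sE /= [RHS]surjective_pairing.
congr (_, _); apply/existsP/idP => [[j]|ep]; first by rewrite inE /= => /andP[].
(* The default letter is of the first block, which a merge excludes. *)
have lt1 : (p.+1 < m + n)%N.
  rewrite ltnNge -sz_e; apply: contraTN (e_ok _ ep) => /(nth_default _) ->.
  by rewrite andbF.
by exists (Ordinal lt1); rewrite inE /= eqxx.
Qed.

Lemma sum_shuffles (V : nmodType) (F : seq (bool * bool) -> V) :
  \sum_(s in shuffles m n)
   \sum_(T : {set 'I_(m + n) * 'I_(m + n)} | T \subset admissible s)
     F (choice_code s T) = \sum_(e <- choice_words m n) F e.
Proof.
rewrite pair_big_dep /=.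
set D := fun p : 'S_(m + n) * {set 'I_(m + n) * 'I_(m + n)} =>
  (p.1 \in shuffles m n) && (p.2 \subset admissible p.1).
rewrite -(big_enum _ _ D (fun p => F (choice_code p.1 p.2))) /=.
rewrite -(big_map (fun p => choice_code p.1 p.2) xpredT F).
apply: perm_big; apply: uniq_perm; last 1 first.
- move=> e; rewrite mem_choice_words; apply/mapP/idP.
    by case=> -[s T]; rewrite mem_enum => /andP[sh sT] ->; apply: choice_code_word.
  case/choice_codeP => s [T [sh sT <-]].
  by exists (s, T); rewrite // mem_enum; apply/andP.
- rewrite map_inj_in_uniq ?enum_uniq // => -[s T] [s' T'].
  rewrite !mem_enum => /andP[sh sT] /andP[sh' sT'] /=; exact: choice_code_inj.
- exact: choice_words_uniq.
Qed.

End Shuffles.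

(** * Linear maps on tensor powers *)

Lemma linear_addE (k : pzRingType) (U V : lmodType k) (f : U -> V) :
  linear f -> {morph f : x y / x + y}.
Proof. by move=> fL x y; have := fL 1 x y; rewrite !scale1r. Qed.

Lemma linear_0 (k : pzRingType) (U V : lmodType k) (f : U -> V) :
  linear f -> f 0 = 0.
Proof. by move=> fL; apply: (addrI (f 0)); rewrite -linear_addE // !addr0. Qed.

Lemma linear_sum_scale (k : pzRingType) (U V : lmodType k) (f : U -> V)
    (I : Type) (r : seq I) (c : I -> k) (x : I -> U) :
  linear f -> f (\sum_(i <- r) c i *: x i) = \sum_(i <- r) c i *: f (x i).
Proof.
move=> fL; elim/big_rec2: _ => [|i y z _ <-]; first exact: linear_0.
by rewrite fL.
Qed.

Lemma tens_ext (k : comPzRingType) (V W : lmodType k) (f g : tens V -> W) :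
  linear f -> linear g -> (forall s, f (pure s) = g (pure s)) -> f =1 g.
Proof. exact: quomod_ext. Qed.

Section Cons.
Variables (k : comPzRingType) (V : lmodType k).

(** Left multiplication by [x] in the tensor algebra. *)
Definition tens_cons (x : V) : tens V -> tens V :=
  quolift (fun s => pure (x :: s)).

Lemma multilinear_cons (x : V) : multilinear (fun s => pure (x :: s)).
Proof. by move=> s1 s2 c y z; apply: (pure_multilinear (x :: s1)). Qed.

Lemma tens_cons_pure x s : tens_cons x (pure s) = pure (x :: s).
Proof.
rewrite /tens_cons quolift_quo ?linext_basis //.
exact: multilinear_rel (@multilinear_cons x).
Qed.

Lemma tens_cons_linearr x : linear (tens_cons x).
Proof. exact: quolift_linear (multilinear_rel (@multilinear_cons x)). Qed.

Lemma tens_cons_linearl t : linear (tens_cons^~ t).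
Proof.
move=> c x y; rewrite /tens_cons /quolift -linext_lincomb.
by apply: eq_linext => s; apply: (pure_multilinear [::]).
Qed.

End Cons.

(** * The recursion for the mixable shuffle product *)

Section MixableWords.
Variables (k : comPzRingType) (lambda : k) (B : comAlgebra k).
Implicit Types (a b : seq B) (e : seq (bool * bool)).

Lemma deal_all_right b : deal (nseq (size b) (false, false)) [::] b =
  [seq (y, false) | y <- b].
Proof. by elim: b => //= y b ->. Qed.

Lemma deal_all_left a : deal (nseq (size a) (true, false)) a [::] =
  [seq (x, false) | x <- a].
Proof. by elim: a => //= x a ->. Qed.

Lemma contract_unmerged a : contract [seq (x, false) | x <- a] = a.
Proof. by elim: a => //= x a ->. Qed.

Lemma count_unmerged i c : count snd (nseq i (c : bool, false)) = 0%N.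
Proof. by rewrite count_nseq. Qed.

Lemma mixed_word_deal m n (u : nat -> B) (s : 'S_(m + n))
    (T : {set 'I_(m + n) * 'I_(m + n)}) : s \in shuffles m n ->
  mixed_word u s T =
  contract (deal (choice_code s T) (map u (iota 0 m)) (map u (iota m n))).
Proof.
by move=> sh; rewrite deal_map deal_choice_code // -map_comp.
Qed.

(** The clauses of the product for empty factors fit this sum too, since then
    there is a single choice word, without merges. *)
Lemma mixable_pure_words a b : mixable_pure lambda a b =
  \sum_(e <- choice_words (size a) (size b))
     lambda ^+ count snd e *: pure (contract (deal e a b)).
Proof.
have [->|a0] := eqVneq a [::].
  by rewrite /= big_seq1 deal_all_right contract_unmerged count_unmerged scale1r.
have [->|b0] := eqVneq b [::].
  rewrite choice_words0 big_seq1 deal_all_left contract_unmerged count_unmerged.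
  by rewrite scale1r; case: a {a0}.
have -> : mixable_pure lambda a b =
    mixable_sum lambda (size a) (size b) (nth 0 (a ++ b)).
  by case: a b a0 b0 => [|? ?] [|? ?].
rewrite -sum_shuffles; apply: eq_bigr => s sh; apply: eq_bigr => T sT.
rewrite (count_merged sT) mixed_word_deal //.
congr (_ *: pure (contract (deal _ _ _))).
  rewrite -[RHS](mkseq_nth 0) /mkseq; apply/eq_in_map => i.
  by rewrite mem_iota nth_cat => /= ->.
rewrite -[in iota _ _](addn0 (size a)) iotaDl -map_comp -[RHS](mkseq_nth 0).
by apply: eq_map => i /=; rewrite nth_cat ltnNge leq_addr addKn.
Qed.

Lemma mixable_pure_cons x a y b :
  mixable_pure lambda (x :: a) (y :: b) =
  tens_cons x (mixable_pure lambda a (y :: b))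
  + tens_cons y (mixable_pure lambda (x :: a) b)
  + lambda *: tens_cons (ca_mul x y) (mixable_pure lambda a b).
Proof.
rewrite !mixable_pure_words !(linear_sum_scale _ _ _ (@tens_cons_linearr _ _ _)).
rewrite /= !big_cat !big_map /= addrA; congr (_ + _ + _).
- by apply: eq_bigr => e _; rewrite tens_cons_pure.
- by apply: eq_bigr => e _; rewrite tens_cons_pure.
rewrite scaler_sumr; apply: eq_bigr => e _.
by rewrite tens_cons_pure scalerA add0n add1n exprS.
Qed.

End MixableWords.

(** * Functoriality of the mixable shuffle algebra *)

Section TensMap.
Variables (k : comPzRingType) (A B : comAlgebra k) (h : A -> B).
Hypotheses (h_linear : linear h) (hM : {morph h : x y / ca_mul x y}).

Lemma contract_map s : contract [seq (h z.1, z.2) | z <- s] = map h (contract s).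
Proof.
have [N] := ubnP (size s); elim: N s => // N IH [|[x [|]] [|[y f] s]] //=.
- by move/ltnW=> lt_s; rewrite hM IH // ltnW.
- by rewrite ltnS => lt_s; congr (_ :: _); apply: (IH ((y, f) :: s)).
Qed.

Lemma tens_map_linear : linear (tens_map h).
Proof.
apply: quolift_linear; apply: multilinear_rel => s1 s2 c x y.
by rewrite !map_cat /= h_linear pure_multilinear.
Qed.

Lemma tens_mapM lambda :
  {morph tens_map h : x y / mixable lambda x y}.
Proof.
move=> x y; move: x; apply: tens_ext => [c u v|c u v|a].
- by rewrite mixable_linearl tens_map_linear.
- by rewrite tens_map_linear mixable_linearl.
move: y; apply: tens_ext => [c u v|c u v|b].
- by rewrite mixable_linearr tens_map_linear.
- by rewrite tens_map_linear mixable_linearr.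
rewrite !tens_map_pure // !mixable_pureE !mixable_pure_words !size_map.
rewrite (linear_sum_scale _ _ _ tens_map_linear); apply: eq_bigr => e _.
by rewrite tens_map_pure // deal_map contract_map.
Qed.

End TensMap.

(** * The quasi-shuffle algebra as a mixable shuffle algebra *)

Section Isomorphism.
Variables (k : comPzRingType) (X : HoffmanSet).
Let A := generated_algebra k X.
Let kX := freemod k X.

Definition word_tensor (w : seq X) : tens kX := pure (map (basis k (S := X)) w).

Definition tensor_of_words : freemod k (seq X) -> tens kX := linext word_tensor.

Lemma tensor_of_words_linear : linear tensor_of_words.
Proof. exact: linearP. Qed.

Lemma tensor_of_words_basis w : tensor_of_words (basis k w) = word_tensor w.
Proof. exact: linext_basis. Qed.

Lemma prepend_linear (a : X) : linear (@prepend k X a).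
Proof. exact: linext_linear. Qed.

Lemma prepend_basis (a : X) w : prepend a (basis k w) = basis k (a :: w).
Proof. exact: linext_basis. Qed.

Lemma tensor_of_words_prepend a f :
  tensor_of_words (prepend a f) = tens_cons (basis k a) (tensor_of_words f).
Proof.
move: f; apply: freemod_ext => [c f g|c f g|w].
- by rewrite prepend_linear tensor_of_words_linear.
- by rewrite tensor_of_words_linear tens_cons_linearr.
by rewrite prepend_basis !tensor_of_words_basis tens_cons_pure.
Qed.

(** Both sides obey the same recursion; a vanishing pairing matches a tensor
    with an entry 0. *)
Lemma tensor_of_qshuffle_word v w :
  tensor_of_words (qshuffle_word k v w) =
  mixable_pure 1 (map (basis k (S := X)) v : seq A) (map (basis k (S := X)) w).
Proof.
elim: v w => [|a v IHv]; first by move=> w; apply: tensor_of_words_basis.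
elim=> [|b w IHw]; first exact: tensor_of_words_basis.
rewrite [map _ (a :: v)]/= [map _ (b :: w)]/= mixable_pure_cons scale1r.
rewrite -[_ :: map _ w]/(map _ (b :: w)) -IHv.
rewrite -[_ :: map _ v]/(map _ (a :: v)) -IHw -IHv.
rewrite -!tensor_of_words_prepend /=.
rewrite !(linear_addE tensor_of_words_linear); congr (_ + _ + _).
rewrite -[gen_mul _ _]/(gen_mul (letter k (Some a)) (letter k (Some b))).
rewrite gen_mul_letter; case: hs_pair => [c|] /=.
  by rewrite -tensor_of_words_prepend.
by rewrite (linear_0 tensor_of_words_linear) (linear_0 (@tens_cons_linearl _ _ _)).
Qed.

Lemma tensor_of_wordsM :
  {morph tensor_of_words : f g / qshuffle f g >-> mixable (1 : k) (B := A) f g}.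
Proof.
move=> f g; move: f; apply: freemod_ext => [c f f'|c f f'|v].
- by rewrite qshuffle_linearl tensor_of_words_linear.
- by rewrite tensor_of_words_linear (@mixable_linearl k 1 A).
move: g; apply: freemod_ext => [c g g'|c g g'|w].
- by rewrite qshuffle_linearr tensor_of_words_linear.
- by rewrite tensor_of_words_linear (@mixable_linearr k 1 A).
rewrite /qshuffle !linext_basis tensor_of_qshuffle_word.
by rewrite !tensor_of_words_basis (@mixable_pureE k 1 A).
Qed.

(** The product of the entries of [s] in the algebra of words under
    concatenation. *)
Fixpoint expand (s : seq kX) : freemod k (seq X) :=
  if s is f :: s' then linext (fun a => prepend a (expand s')) f
  else basis k [::].

Lemma expand_multilinear : multilinear expand.
Proof.
elim=> [|f s1 IH] s2 c x y /=; first exact: linext_linear.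
rewrite -linext_lincomb; apply: eq_linext => a.
by rewrite IH prepend_linear.
Qed.

Definition words_of_tensor : tens kX -> freemod k (seq X) := quolift expand.

Lemma words_of_tensor_linear : linear words_of_tensor.
Proof. exact: quolift_linear (multilinear_rel expand_multilinear). Qed.

Lemma words_of_tensor_pure s : words_of_tensor (pure s) = expand s.
Proof.
rewrite /words_of_tensor quolift_quo ?linext_basis //.
exact: multilinear_rel expand_multilinear.
Qed.

Lemma tensor_of_wordsK : cancel tensor_of_words words_of_tensor.
Proof.
apply: freemod_ext => [c f g|//|w].
  by rewrite tensor_of_words_linear words_of_tensor_linear.
rewrite tensor_of_words_basis words_of_tensor_pure.
by elim: w => //= a w ->; rewrite linext_basis prepend_basis.
Qed.

Lemma words_of_tensorK : cancel words_of_tensor tensor_of_words.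
Proof.
apply: tens_ext => [c f g|//|s].
  by rewrite words_of_tensor_linear tensor_of_words_linear.
rewrite words_of_tensor_pure; elim: s => [|f s IH] /=.
  by rewrite tensor_of_words_basis.
rewrite -tens_cons_pure -IH; move: f; apply: freemod_ext => [c f g|c f g|a].
- by rewrite linext_linear tensor_of_words_linear.
- exact: tens_cons_linearl.
by rewrite linext_basis tensor_of_words_prepend.
Qed.

Lemma tensor_of_words_morphism :
  algebra_morphism (A := QuasiShuffle k X) (B := ShPlus 1 A) tensor_of_words.
Proof.
split; [exact: tensor_of_words_linear | exact: tensor_of_words_basis |].
exact: tensor_of_wordsM.
Qed.

End Isomorphism.

(** * The copy of the mixable shuffle algebra with unit first factor *)

Section OneTensor.
Variables (k : comPzRingType) (A B : unitalAlgebra k).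

Lemma one_tensor_morphism :
  algebra_morphism (B := tensor_algebra A B) (tprod (ua_one : A)).
Proof.
split; [exact: tprod_linearr | by [] | move=> x y].
by rewrite /= tensor_mulE ua_mul1l.
Qed.

End OneTensor.

(** A linear form with value 1 at [v] yields the retraction sending a tensor
    v' (x) w to (p v') w. *)
Lemma tprod_inj (k : comPzRingType) (V W : lmodType k) (v : V) (p : V -> k^o) :
  linear p -> p v = 1 -> injective (tprod (W := W) v).
Proof.
move=> pL pv; pose g (z : V * W) := (p z.1 : k) *: z.2.
apply: (can_inj (g := quolift g)) => w; rewrite /quolift.
rewrite [LHS]quolift_quo ?linext_basis /g /= ?pv ?scale1r //.
apply: bilinear_rel => [w'|v'] c x y; rewrite /g /=.
  by rewrite pL scalerDl -scalerA.
by rewrite scalerDr !scalerA mulrC.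
Qed.

Section Embedding.
Variables (k : comPzRingType) (lambda : k) (A : comAlgebra k).
Let iota := @unitarization_inj k A.
Let iota_linear : linear iota := @unitarization_inj_linear k A.

Lemma unitarization_injM : {morph iota : x y / ca_mul x y}.
Proof.
move=> x y; apply/pair_equal_spec; split; rewrite /= ?mulr0 //.
by rewrite !scale0r !add0r.
Qed.

Definition one_tensor_embedding (t : ShPlus lambda A) : Sh lambda (unitarization A) :=
  tprod cua_one (tens_map iota t).

Lemma one_tensor_embedding_morphism : algebra_morphism one_tensor_embedding.
Proof.
have [tL t1 tM] := one_tensor_morphism (unital_of_com (unitarization A))
  (ShPlus lambda (unitarization A)).
rewrite /one_tensor_embedding; split.
- by move=> c x y; rewrite (tens_map_linear iota_linear) tL.
- by rewrite -t1 /= tens_map_pure.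
move=> x y; rewrite -tM; congr tprod.
exact: tens_mapM iota_linear unitarization_injM _ _ _.
Qed.

Lemma one_tensor_embedding_inj : injective one_tensor_embedding.
Proof.
have sndL : linear (snd : unitarization A -> A) by [].
have fstL : linear (fst : unitarization A -> k^o) by [].
apply: inj_comp; first exact: (tprod_inj fstL).
apply: (can_inj (g := tens_map snd)); apply: tens_ext => [c x y|//|s].
  rewrite /= (tens_map_linear iota_linear).
  by rewrite (tens_map_linear (A := unitarization A) sndL).
by rewrite !tens_map_pure // -map_comp map_id.
Qed.

End Embedding.

Lemma morphism_comp (k : comPzRingType) (A B C : unitalAlgebra k)
    (f : A -> B) (g : B -> C) :
  algebra_morphism f -> algebra_morphism g -> algebra_morphism (g \o f).
Proof.
case=> fL f1 fM [gL g1 gM]; split.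
- by move=> c x y; rewrite /= fL gL.
- by rewrite /= f1.
- by move=> x y; rewrite /= fM gM.
Qed.

Lemma image_subalgebra (k : comPzRingType) (A B : unitalAlgebra k) (f : A -> B) :
  algebra_morphism f -> subalgebra (fun y => exists x, y = f x).
Proof.
case=> fL f1 fM; split; [split | by exists ua_one; rewrite f1 |].
- by exists 0; rewrite (linear_0 fL).
- by move=> c _ _ [x ->] [y ->]; exists (c *: x + y); rewrite fL.
- by move=> _ _ [x ->] [y ->]; exists (ua_mul x y); rewrite fM.
Qed.

Theorem theorem2p5 (k : comPzRingType) (X : HoffmanSet) :
  algebra_isomorphic (QuasiShuffle k X)
    (ShPlus (1%R : k) (generated_algebra k X)) /\
  isomorphic_to_subalgebra (QuasiShuffle k X)
    (B := Sh (1%R : k) (generated_unital_algebra k X))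
    (@one_tensor_ShPlus k 1%R (generated_algebra k X)).
Proof.
have isoM := tensor_of_words_morphism k X.
have embM := one_tensor_embedding_morphism 1 (generated_algebra k X).
split.
  exists (@tensor_of_words k X); split=> //.
  exists (@words_of_tensor k X); [exact: tensor_of_wordsK | exact: words_of_tensorK].
split; first exact: image_subalgebra embM.
exists (@one_tensor_embedding k 1 (generated_algebra k X) \o @tensor_of_words k X).
split; first exact: morphism_comp isoM embM.
  apply: inj_comp; first exact: one_tensor_embedding_inj.
  exact: can_inj (@tensor_of_wordsK k X).
move=> y; split=> [[t ->]|[f <-]]; last by exists (tensor_of_words f).
by exists (words_of_tensor t); rewrite /= words_of_tensorK.
Qed.
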